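(* A multiplicative function $f:\mathbb{N}\to\mathbb{C}$ satisfies \[ f(x^2-xy+y^2) = f(x)^2-f(x)\,f(y)+f(y)^2 \] for all positive integers $x,y$ if and only if $f$ is one of the following: (1) the identity function $f(n)=n$; (2) the constant function $f(n)=1$; (3) the function $f_p$ defined by $f_p(n)=0$ if $p\mid n$ and $f_p(n)=1$ if $p\nmid n$, for some prime $p\equiv 2 \pmod{3}$.
   Context: $\mathbb{N}$ denotes the set of positive integers. A function $f:\mathbb{N}\to\mathbb{C}$ is multiplicative if $f(1)=1$ and $f(mn)=f(m)f(n)$ for all coprime positive integers $m,n$. *)

(* Defs.v *)
From HB Require Import structures.
From mathcomp Require Import all_boot all_order all_algebra.
From mathcomp Require Import reals.
From mathcomp Require Import complex.

Set Implicit Arguments.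
Unset Strict Implicit.
Unset Printing Implicit Defensive.

Local Open Scope ring_scope.

(* The complex numbers are R[i] for R : realType. A function on the positive
   integers is represented by f : nat -> R[i]; the value f 0 is junk, and
   neither predicate below depends on it. The predicate is not to be confused
   with GRing.Theory.multiplicative (monoid morphisms). *)
Definition arith_multiplicative (R : realType) (f : nat -> R[i]) : Prop :=
  f 1%N = 1 /\
  forall m n : nat, (0 < m)%N -> (0 < n)%N -> coprime m n ->
    f (m * n)%N = f m * f n.

Definition eq_on_pos (R : realType) (f g : nat -> R[i]) : Prop :=
  forall n : nat, (0 < n)%N -> f n = g n.

Definition nondvd_indicator (R : realType) (p : nat) : nat -> R[i] :=
  fun n => if (p %| n)%N then 0 else 1.

(* Subtraction on nat truncates at 0, so it comes last: it is exact there
   because x * y <= x ^ 2 + y ^ 2. *)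
Definition qform (x y : nat) : nat := (x ^ 2 + y ^ 2 - x * y)%N.

Lemma qformE (x y : nat) :
  (qform x y)%:Z = x%:Z ^+ 2 - x%:Z * y%:Z + y%:Z ^+ 2.
Proof.
have le_xy : (x * y <= x ^ 2 + y ^ 2)%N.
  apply: leq_trans (nat_Cauchy x y).
  by rewrite mul2n -addnn leq_addr.
rewrite /qform -subzn // PoszD -!mulnn !PoszM !GRing.expr2.
by rewrite GRing.addrAC.
Qed.

(* Main.v *)
(* The form takes the same value at (y + z, y) and at (y + z, z), so for all y, z
   either f y = f z or f (y + z) = f y + f z. With f 3 = f 2 ^ 2 - f 2 + 1 this
   forces f 2 to be 0, 1 or 2. If f 2 = 2, taking z = 1 gives f n = n by
   induction. Otherwise f only takes the values 0 and 1, and its zeros, if any,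
   are exactly the multiples of the least one, p, which is prime by
   multiplicativity. Finally f (x ^ 2 - x + 1) = 1 for every x, so p divides no
   value of x ^ 2 - x + 1, which excludes p = 3 and p = 1 mod 3. *)

Require Import Defs.
From HB Require Import structures.
From mathcomp Require Import all_boot all_order all_algebra.
From mathcomp Require Import all_fingroup all_solvable all_field.
From mathcomp Require Import reals.
From mathcomp Require Import complex.
From mathcomp Require Import ring zify.

Set Implicit Arguments.
Unset Strict Implicit.
Unset Printing Implicit Defensive.

Import GRing.Theory Num.Theory.
Local Open Scope ring_scope.

Lemma natr_qform (A : comNzRingType) (x y : nat) :
  (qform x y)%:R = x%:R ^+ 2 - x%:R * y%:R + y%:R ^+ 2 :> A.
Proof.
by rewrite pmulrn qformE !(rmorphD, rmorphN, rmorphM, rmorphXn) /= -!pmulrn.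
Qed.

Lemma qform_gt0 (x y : nat) : (0 < x)%N -> (0 < qform x y)%N.
Proof. rewrite /qform -!mulnn; nia. Qed.

Lemma qform_sub (y z : nat) : qform (y + z) y = qform (y + z) z.
Proof. rewrite /qform -!mulnn; nia. Qed.

Lemma qform_diag (x : nat) : qform x x = (x ^ 2)%N.
Proof. by rewrite /qform mulnn addnK. Qed.

Lemma dvdn_natr_Fp (p n : nat) :
  prime p -> (p %| n)%N = (n%:R == 0 :> 'F_p).
Proof. by move=> p_pr; rewrite (dvdn_pcharf (pchar_Fp p_pr)). Qed.

(** A zero of the form in ['F_p] satisfies a^3 = (-b)^3, and cubing is injective there, so a = -b
    and the form becomes 3 b^2. This is what makes [nondvd_indicator] a solution. *)
Lemma dvdn_qform (p x y : nat) : prime p -> p = 2 %[mod 3] ->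
  (p %| qform x y)%N = (p %| x)%N && (p %| y)%N.
Proof.
move=> p_pr p_mod3; rewrite !dvdn_natr_Fp // natr_qform.
move: (x%:R : 'F_p) (y%:R : 'F_p) => a b.
apply/eqP/andP=> [q0|[/eqP-> /eqP->]]; last by ring.
have cube : a ^+ 3 = (- b) ^+ 3.
  apply/eqP; rewrite -subr_eq0; apply/eqP.
  by transitivity ((a + b) * (a ^+ 2 - a * b + b ^+ 2)); [ring | rewrite q0 mulr0].
have [k p_def] : exists k, p = (3 * k + 2)%N.
  by exists (p %/ 3)%N; rewrite {1}(divn_eq p 3) p_mod3 mulnC.
have three_neq0 : 3%:R != 0 :> 'F_p.
  rewrite -dvdn_natr_Fp // dvdn_prime2 //.
  by apply: contra_eq_neq p_mod3 => ->.
(* Cubing is injective modulo p, as its composite with the (2k+1)-th power is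
   the map x |-> x ^ (2p - 1) = x. *)
have cubeK (c : 'F_p) : (c ^+ 3) ^+ (2 * k + 1)%N = c.
  have cp : c ^+ p = c by have := expf_card c; rewrite card_Fp.
  rewrite -exprM.
  have -> : (3 * (2 * k + 1) = p + (p - 1))%N by lia.
  by rewrite exprD cp -exprS -[RHS]cp; congr (_ ^+ _); lia.
have ab : a = - b by rewrite -(cubeK a) cube cubeK.
have : 3%:R * b ^+ 2 = 0 by rewrite -q0 ab; ring.
move/eqP; rewrite mulf_eq0 (negPf three_neq0) expf_eq0 /= => /eqP b0.
by rewrite ab b0 oppr0 eqxx.
Qed.

(** As 3 divides p - 1, Cauchy's theorem gives a unit w of order 3 in ['F_p]; then w^2 + w + 1 = 0,
    so -w is a root of x^2 - x + 1. *)
Lemma qform1_root (p : nat) : prime p -> p = 1 %[mod 3] ->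
  exists2 x : nat, (0 < x)%N & (p %| qform x 1)%N.
Proof.
move=> p_pr p_mod3.
have dvd3 : (3 %| #|[set: {unit 'F_p}]%G|)%N.
  rewrite card_finField_unit card_Fp // -subn1.
  by rewrite -eqn_mod_dvd ?prime_gt0 //; apply/eqP.
have [u _ u3] := Cauchy (isT : prime 3) dvd3.
have w3 : (val u : 'F_p) ^+ 3 = 1 by rewrite -FinRing.val_unitX -u3 expg_order.
have w1 : val u - 1 != 0 :> 'F_p.
  rewrite subr_eq0; apply/eqP => wu1.
  have u1 : u = 1%g by apply: val_inj.
  by move: u3; rewrite u1 order1.
have root_w : val u ^+ 2 + val u + 1 = 0 :> 'F_p.
  apply: (mulfI w1); rewrite mulr0.
  by transitivity ((val u : 'F_p) ^+ 3 - 1); [ring | rewrite w3 subrr].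
have w0 : (- val u : 'F_p) != 0.
  rewrite oppr_eq0; apply: contra_eq_neq w3 => ->.
  by rewrite exprS mul0r eq_sym oner_eq0.
(* The residue -w is read as its representative below [p], positive because -w is nonzero. *)
exists (- val u : 'F_p).
  by rewrite lt0n; apply: contra_neq w0 => w0; apply: val_inj.
rewrite dvdn_natr_Fp // natr_qform natr_Zp; apply/eqP.
by rewrite -[RHS]root_w; ring.
Qed.

Section QuadraticEquation.

Variables (R : realType) (f : nat -> R[i]).
Hypothesis f_mult : arith_multiplicative f.
Hypothesis f_qform : forall x y : nat, (0 < x)%N -> (0 < y)%N ->
  f (qform x y) = f x ^+ 2 - f x * f y + f y ^+ 2.

Let f1 : f 1%N = 1 := proj1 f_mult.

Lemma f_sqr x : (0 < x)%N -> f (x ^ 2)%N = f x ^+ 2.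
Proof. by move=> x0; rewrite -qform_diag f_qform //; ring. Qed.

Lemma f_eq_or_add y z : (0 < y)%N -> (0 < z)%N ->
  f y = f z \/ f (y + z)%N = f y + f z.
Proof.
move=> y0 z0.
(* The terms f(y + z)^2 cancel between the two expansions, and the difference factors. *)
have /eqP : (f y - f z) * (f y + f z - f (y + z)%N) = 0.
  have := congr1 f (qform_sub y z).
  rewrite !f_qform ?addn_gt0 ?y0 // => /eqP; rewrite -subr_eq0 => /eqP e.
  by rewrite -[RHS]e; ring.
rewrite mulf_eq0 !subr_eq0 => /orP[] /eqP; first by left.
by right.
Qed.

Lemma f3E : f 3%N = f 2%N ^+ 2 - f 2%N + 1.
Proof. by rewrite (_ : 3%N = qform 2 1) // f_qform // f1; ring. Qed.

(** Compare 3 and 1: either f 3 = 1, a quadratic with roots 0 and 1 in f 2, or f 4 = f 3 + 1, which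
    is linear in f 2 because f 4 = (f 2)^2. *)
Lemma f2_values : [\/ f 2%N = 0, f 2%N = 1 | f 2%N = 2%:R].
Proof.
have f4 := f_sqr (isT : 0 < 2)%N.
have [] := @f_eq_or_add 3 1 isT isT; rewrite f1 f3E => e.
  have /eqP : f 2%N * (f 2%N - 1) = 0.
    by apply: (addIr 1); rewrite add0r -[RHS]e; ring.
  rewrite mulf_eq0 subr_eq0 => /orP[] /eqP; first by constructor 1.
  by constructor 2.
constructor 3; apply/esym/eqP; rewrite -subr_eq0; apply/eqP.
transitivity (f 2%N ^+ 2 - f 2%N + 1 + 1 - f 2%N ^+ 2); first by ring.
by rewrite -e -f4 subrr.
Qed.

Lemma f_eq_id : f 2%N = 2%:R -> eq_on_pos f (fun n => n%:R).
Proof.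
move=> f2; case=> [|[|n]] // _.
elim: n => // n IHn.
case: (@f_eq_or_add n.+2 1 isT isT); rewrite f1 IHn.
  by move/eqP; rewrite pnatr_eq1.
by rewrite addn1 => ->; rewrite -[1]/(1%:R) -natrD addn1.
Qed.

(** Any other value f n would force f (n + 2) = f n + 2; comparing n with 2 then gives f n = f 2 or
    f 2 = 2, both excluded. *)
Lemma f_zero_one : f 2%N = 0 \/ f 2%N = 1 ->
  forall n, (0 < n)%N -> f n = 0 \/ f n = 1.
Proof.
move=> f2 n n0.
case: (eqVneq (f n) 0) => [|fn0]; first by left.
case: (eqVneq (f n) 1) => [|fn1]; first by right.
have fn1' : f n.+1 = f n + 1.
  case: (@f_eq_or_add n 1 n0 isT); rewrite f1; first by move/eqP; rewrite (negPf fn1).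
  by rewrite addn1.
have fn2' : f n.+2 = f n + 1 + 1.
  case: (@f_eq_or_add n.+1 1 isT isT); rewrite f1 fn1' ?addn1 //.
  by move/eqP; rewrite -{2}[1]add0r (inj_eq (addIr 1)) (negPf fn0).
case: (@f_eq_or_add n 2 n0 isT); rewrite ?addn2 ?fn2'.
  by case: f2 => ->; [left | right].
by case: f2 => ->; rewrite -addrA => /addrI /eqP;
  rewrite -mulr2n ?pnatr_eq0 ?pnatr_eq1.
Qed.

Lemma f_one_or_indicator (f01 : forall n, (0 < n)%N -> f n = 0 \/ f n = 1) :
  eq_on_pos f (fun _ => 1) \/
  exists p : nat,
    [/\ prime p, p = 2 %[mod 3] & eq_on_pos f (nondvd_indicator R p)].
Proof.
case: (boolp.pselect (exists n, (0 < n)%N && (f n == 0))) => [exZ|noZ]; last first.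
  left=> n n0; case: (f01 n n0) => // fn0.
  by case: noZ; exists n; rewrite n0 fn0 eqxx.
right.
case: (ex_minnP exZ) => p /andP[p0 /eqP fp0] p_min.
have f_lt m : (0 < m)%N -> (m < p)%N -> f m = 1.
  move=> m0 mp; case: (f01 m m0) => // fm0.
  by have := p_min m; rewrite m0 fm0 eqxx leqNgt mp => /(_ isT).
have f_addp m : (0 < m)%N -> f m = 1 -> f (m + p)%N = 1.
  move=> m0 fm; case: (f_eq_or_add m0 p0); rewrite fm fp0 ?addr0 //.
  by move/eqP; rewrite oner_eq0.
have f_addMp m k : (0 < m)%N -> f m = 1 -> f (k * p + m)%N = 1.
  move=> m0 fm; elim: k => // k IHk.
  by rewrite mulSn -addnA addnC f_addp // addn_gt0 m0 orbT.
have f_ndvd n : ~~ (p %| n)%N -> f n = 1.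
  move=> pn; rewrite (divn_eq n p); apply: f_addMp; first by rewrite lt0n.
  by apply: f_lt; [rewrite lt0n | rewrite ltn_mod].
(* A zero stays a zero after subtracting multiples of p, and f vanishes at
   p (n p + 1), which lies beyond n. *)
have f_dvd n : (0 < n)%N -> (p %| n)%N -> f n = 0.
  move=> n0 /dvdnP[k n_def]; case: (f01 n n0) => // fn1.
  have := f_addMp n (n * p + 1 - k)%N n0 fn1.
  rewrite {2}n_def -mulnDl subnK; last by nia.
  rewrite mulnC (proj2 f_mult) ?addn1 // ?fp0 ?mul0r.
    by move/esym/eqP; rewrite oner_eq0.
  by rewrite -addn1 /coprime gcdnMDl gcdn1.
have p_gt1 : (1 < p)%N.
  rewrite ltn_neqAle p0 andbT; apply: contra_eq_neq fp0 => <-.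
  by rewrite f1 oner_eq0.
have p_pr : prime p.
  (* Split p = m q with q the least prime factor. If m and q are coprime, then f p = f m * f q = 1.
     Otherwise q divides m, so p divides m^2, although f (m^2) = (f m)^2 = 1. *)
  apply/negPn/negP => p_npr.
  have q_pr := pdiv_prime p_gt1; have /dvdnP[m p_def] := pdiv_dvd p.
  have q_lt : (pdiv p < p)%N.
    rewrite ltn_neqAle pdiv_leq // andbT.
    by apply: contraNneq p_npr => <-.
  move: (pdiv p) q_pr q_lt p_def => q q_pr q_lt p_def.
  have q_gt1 := prime_gt1 q_pr.
  have m0 : (0 < m)%N by case: (m) p_def p0 => // ->.
  have m_lt : (m < p)%N by rewrite p_def ltn_Pmulr.
  have fm := f_lt m m0 m_lt.
  have fq := f_lt q (ltnW q_gt1) q_lt.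
  case: (boolP (coprime m q)) => [cmq|].
    have := proj2 f_mult m q m0 (ltnW q_gt1) cmq.
    rewrite -p_def fp0 fm fq mulr1 => /esym/eqP.
    by rewrite oner_eq0.
  rewrite coprime_sym prime_coprime // negbK => q_m.
  have : f (m ^ 2)%N = 0.
    by apply: f_dvd; rewrite ?expn_gt0 ?m0 // p_def -mulnn dvdn_mul.
  by rewrite f_sqr // fm expr1n => /eqP; rewrite oner_eq0.
exists p; split=> //; last first.
  move=> n n0; rewrite /nondvd_indicator.
  by case: ifP => [/f_dvd->|/negbT/f_ndvd].
have q1 x : (0 < x)%N -> f (qform x 1) = 1.
  by move=> x0; rewrite f_qform // f1; case: (f01 x x0) => ->; ring.
have : (p %% 3 < 3)%N by rewrite ltn_mod.
(* Residue 0 means p = 3 = [qform 2 1]; for residue 1, some [qform x 1] is a multiple of [p]. Either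
   way [f] would be both 0 and 1 there. *)
case p_mod3 : (p %% 3)%N => [|[|[|]]] // _.
  have p3 : p = 3%N.
    by apply/esym/eqP; rewrite -dvdn_prime2 // /dvdn p_mod3.
  have := q1 2%N isT; rewrite (_ : qform 2 1 = p) ?p3 // -p3 fp0.
  by move/esym/eqP; rewrite oner_eq0.
have [x x0 p_x] := qform1_root p_pr p_mod3.
have := q1 x x0; rewrite f_dvd // ?qform_gt0 //.
by move/esym/eqP; rewrite oner_eq0.
Qed.

End QuadraticEquation.

Theorem theorem2 (R : realType) (f : nat -> R[i])
    (hf : arith_multiplicative f) :
  (forall x y : nat, (0 < x)%N -> (0 < y)%N ->
     f (qform x y) = f x ^+ 2 - f x * f y + f y ^+ 2)
  <->
  [\/ eq_on_pos f (fun n => n%:R),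
      eq_on_pos f (fun _ => 1)
    | exists p : nat,
        [/\ prime p, p = 2 %[mod 3] & eq_on_pos f (nondvd_indicator R p)]].
Proof.
split=> [f_qform | ].
  have f2_01 : f 2%N = 0 \/ f 2%N = 1 ->
      eq_on_pos f (fun _ => 1) \/ exists p : nat,
        [/\ prime p, p = 2 %[mod 3] & eq_on_pos f (nondvd_indicator R p)].
    by move=> f2; apply: f_one_or_indicator => //; apply: f_zero_one.
  have [f2|f2|f2] := f2_values hf f_qform.
  - by case: f2_01; [left | constructor 2 | constructor 3].
  - by case: f2_01; [right | constructor 2 | constructor 3].
  - by constructor 1; apply: f_eq_id.
case=> [fE|fE|[p [p_pr p_mod3 fE]]] x y x0 y0; rewrite !fE ?qform_gt0 //.
- exact: natr_qform.
- by ring.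
- rewrite /nondvd_indicator dvdn_qform //.
  by case: (p %| x)%N; case: (p %| y)%N => /=; ring.
Qed.
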